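(* Under the standing smoothness and normalized Jacobi-nondegeneracy hypotheses, the universal response differential of the core package satisfies, in the fixed local trivialization, $$\mathcal D_{g_0}(X)=\left(\mathfrak J_{g_0}(X),\;-G_0\,\mathfrak J_{g_0}(X)\,G_0\right)\qquad (X\in T_{p_0}S).$$ Consequently $\ker\mathcal D_{g_0}=\ker\mathfrak J_{g_0}$. In particular, the core Jacobi--Green package is infinitesimally complete on the chosen Einstein family (i.e. $\mathcal D_{g_0}$ is injective) if and only if the effective Jacobi-response operator $\mathfrak J_{g_0}:T_{p_0}S\to\mathcal L(\mathscr H_{p_0}^{k+2,\alpha},\mathscr Y_{p_0}^{k,\alpha})$ is injective.
   Context: $M$ is a compact manifold with a smooth cohomogeneity-one action of a Lie group $\mathsf G$ with orbit space a closed interval. A normalized Einstein metric is a $\mathsf G$-invariant metric $g$ with $\operatorname{Ric}(g)=\lambda g$ ($\lambda>0$ fixed), normalized by a fixed unit-speed normal geodesic joining the two singular orbits. A smooth parameterized Einstein family is a smooth finite-dimensional manifold $S$ with normalized Einstein metrics $g_p$, $p\in S$, whose coefficients depend smoothly on $(p,x)\in S\times M$; write $\mathbf g:p\mapsto g_p$ (not assumed immersive), and $g_{p_0}=g_0$. Probe data: a compact Riemannian target $(N,h)$ with compatible $\mathsf G$-action, an equivariant homotopy class of maps $M\to N$, endpoint, smoothness and normalization conditions, and a reference harmonic map $f_0:(M,g_0)\to(N,h)$ satisfying them. Standing smoothness hypotheses: with $k\ge4$, $0<\alpha<1$, the constrained equivariant $C^{k+2,\alpha}$ maps form a smooth Banach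 manifold $\mathcal H^{k+2,\alpha}$; $\mathcal Y^{k,\alpha}$ is the Banach bundle with fibre over $f$ the equivariant $C^{k,\alpha}$ sections of $f^*TN$; $\mathcal G$ is a Banach manifold of normalized cohomogeneity-one metrics, $\mathbf g:S\to\mathcal G$ is smooth, and $\mathcal F(g,f)=\tau_g(f)$ (tension field) is smooth on $\mathcal G\times\mathcal H^{k+2,\alpha}$ in fixed local trivializations. Normalized Jacobi nondegeneracy: $J_{g_0}=D_f\mathcal F(g_0,f_0):T_{f_0}\mathcal H^{k+2,\alpha}\to\mathcal Y^{k,\alpha}_{f_0}$ is an isomorphism. By the implicit function theorem, after shrinking $S$ around $p_0$, there is a unique smooth map $\Pi_E:S\to\mathcal H^{k+2,\alpha}$, $p\mapsto f_p$, near $f_0$, with $f_{p_0}=f_0$ and $\mathcal F(g_p,f_p)=0$, and $J_p:=D_f\mathcal F(g_p,f_p):\mathscr H_p^{k+2,\alpha}:=T_{f_p}\mathcal H^{k+2,\alpha}\to\mathscr Y_p^{k,\alpha}:=\mathcal Y_{f_p}^{k,\alpha}$ is invertible for all $p$; $G_p:=J_p^{-1}$, and $J_0=J_{p_0}$, $G_0=G_{p_0}$. In fixed smooth local trivializations the spaces $\mathscr H_p^{k+2,\alpha},\mathscr Y_p^{k,\alpha}$ are identified with $\mathscr H_{p_0}^{k+2,\alpha},\mathscr Y_{p_0}^{k,\alpha}$, and $J(g,f):=D_f\mathcal F(g,f)$ is a smooth function of $(g,f)$ near $(g_0,f_0)$ with values in $\mathcal L(\mathscr H_{p_0}^{k+2,\alpha},\mathscr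 Y_{p_0}^{k,\alpha})$, with partial derivatives $D_gJ$, $D_fJ$. The core analytical package is $p\mapsto(J_p,G_p)$, a smooth map into $\mathcal L(\mathscr H_{p_0}^{k+2,\alpha},\mathscr Y_{p_0}^{k,\alpha})\times\mathcal L(\mathscr Y_{p_0}^{k,\alpha},\mathscr H_{p_0}^{k+2,\alpha})$ in the trivialization; its differential at $p_0$ is the universal response differential $\mathcal D_{g_0}$, with domain $T_{p_0}S$. Set $K_0:=D_g\mathcal F(g_0,f_0)\circ D\mathbf g_{p_0}$, $h_X:=D\mathbf g_{p_0}[X]$ and $\dot f_X:=D(\Pi_E)_{p_0}[X]=-G_0K_0[X]$. The effective Jacobi-response operator is $$\mathfrak J_{g_0}(X):=\left.D_p\big(J(g_p,f_p)\big)\right|_{p_0}[X]=D_gJ_{(g_0,f_0)}[h_X]+D_fJ_{(g_0,f_0)}[\dot f_X].$$ *)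

(* Defs.v *)
From HB Require Import structures.
From mathcomp Require Import all_boot all_order all_algebra.
From mathcomp Require Import all_classical all_reals all_analysis.
Set Implicit Arguments.
Unset Strict Implicit.
Unset Printing Implicit Defensive.
Import Order.TTheory GRing.Theory Num.Theory.
Import numFieldNormedType.Exports.
Local Open Scope classical_set_scope.
Local Open Scope ring_scope.

Section BoundedOperators.
Context {R : realType}.

Definition clin (E F : normedModType R) : {pred (E -> F)} :=
  fun f => `[< linear f /\ continuous f >].
Arguments clin : clear implicits.

Record bop (E F : normedModType R) := Bop {
  bop_fun :> E -> F;
  bop_clin : bop_fun \in clin E F }.

HB.instance Definition _ (E F : normedModType R) := [isSub of bop E F for @bop_fun E F].
HB.instance Definition _ (E F : normedModType R) := [Choice of bop E F by <:].

Lemma clin_submod_closed (E F : normedModType R) : submod_closed (clin E F).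
Proof.
split.
  apply/asboolP; split; last exact: (@cst_continuous E F 0).
  by move=> a x y; rewrite /= scaler0 addr0.
move=> a f g /asboolP[lf cf] /asboolP[lg cg]; apply/asboolP; split.
  move=> b x y; rewrite !fctE lf lg !scalerDr !scalerA (mulrC a b).
  by rewrite addrACA.
move=> x; apply: continuousD; last exact: cg.
by apply: continuousZl_tmp; exact: cf.
Qed.

HB.instance Definition _ (E F : normedModType R) := GRing.isSubmodClosed.Build R (E -> F)
  (clin E F) (@clin_submod_closed E F).
HB.instance Definition _ (E F : normedModType R) := [SubChoice_isSubLmodule of bop E F by <:].

Lemma bop_linear (E F : normedModType R) (A : bop E F) : linear A.
Proof. by case/asboolP: (bop_clin A). Qed.

Lemma bop_continuous (E F : normedModType R) (A : bop E F) : continuous A.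
Proof. by case/asboolP: (bop_clin A). Qed.

HB.instance Definition _ (E F : normedModType R) (A : bop E F) :=
  GRing.isLinear.Build R E F *:%R A (bop_linear A).

Definition bop_bounds (E F : normedModType R) (A : bop E F) : set R :=
  [set C | 0 <= C /\ forall x, `|A x| <= C * `|x|].

Definition opnorm (E F : normedModType R) (A : bop E F) : R :=
  inf (bop_bounds A).

Lemma bop_bounds_lb (E F : normedModType R) (A : bop E F) :
  lbound (bop_bounds A) 0.
Proof. by move=> C []. Qed.

Lemma bop_bounds_neq0 (E F : normedModType R) (A : bop E F) :
  bop_bounds A !=set0.
Proof.
have /linear_bounded_continuous/linear_boundedP := @bop_continuous _ _ A.
move=> /pinfty_ex_gt0[C C0 AC].
by exists C; split; [exact: ltW|exact: AC].
Qed.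

Lemma opnorm_ge0 (E F : normedModType R) (A : bop E F) : 0 <= opnorm A.
Proof. by apply: lb_le_inf; [exact: bop_bounds_neq0|exact: bop_bounds_lb]. Qed.

Lemma opnorm_le (E F : normedModType R) (A : bop E F) C :
  0 <= C -> (forall x, `|A x| <= C * `|x|) -> opnorm A <= C.
Proof.
by move=> C0 AC; apply: ge_inf => //; exists 0; exact: bop_bounds_lb.
Qed.

Lemma opnormP (E F : normedModType R) (A : bop E F) x :
  `|A x| <= opnorm A * `|x|.
Proof.
have [->|x0] := eqVneq x 0; first by rewrite linear0 !normr0 mulr0.
rewrite -ler_pdivrMr ?normr_gt0//; apply: lb_le_inf.
  exact: bop_bounds_neq0.
by move=> C [_ AC]; rewrite ler_pdivrMr ?normr_gt0.
Qed.

Lemma opnormD (E F : normedModType R) (A B : bop E F) :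
  opnorm (A + B) <= opnorm A + opnorm B.
Proof.
apply: opnorm_le => [|x]; first by rewrite addr_ge0 ?opnorm_ge0.
by rewrite mulrDl (le_trans (ler_normD _ _)) ?lerD ?opnormP.
Qed.

Lemma opnormZ (E F : normedModType R) a (A : bop E F) :
  opnorm (a *: A) = `|a| * opnorm A.
Proof.
have le b B : opnorm (b *: B : bop E F) <= `|b| * opnorm B.
  apply: opnorm_le => [|x]; first by rewrite mulr_ge0 ?opnorm_ge0.
  by rewrite [_ x]/(b *: B x) normrZ -mulrA ler_wpM2l ?opnormP.
apply/eqP; rewrite eq_le le/=.
have [->|a0] := eqVneq a 0; first by rewrite normr0 mul0r opnorm_ge0.
rewrite -ler_pdivlMl ?normr_gt0// -normfV.
by rewrite -{1}[A](scalerK a0) le.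
Qed.

Lemma opnorm_eq0 (E F : normedModType R) (A : bop E F) : opnorm A = 0 -> A = 0.
Proof.
move=> A0; apply/val_inj/funext => x; apply/eqP.
by rewrite -normr_le0 (le_trans (opnormP A x))// A0 mul0r.
Qed.

HB.instance Definition _ (E F : normedModType R) :=
  Lmodule_isNormed.Build R (bop E F) (@opnormD E F) (@opnormZ E F)
    (@opnorm_eq0 E F).


Definition to_bop (E F : normedModType R) (f : E -> F) : bop E F :=
  insubd (0 : bop E F) f.

Lemma bop_comp_subproof (E F G : normedModType R) (A : bop F G) (B : bop E F) :
  (A \o B) \in clin E G.
Proof.
apply/asboolP; split; first by move=> a x y /=; rewrite !linearP.
by move=> x; apply: continuous_comp; exact: bop_continuous.
Qed.

Definition bop_comp (E F G : normedModType R) (A : bop F G) (B : bop E F) :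
  bop E G := Bop (bop_comp_subproof A B).

Definition bop_inverse (E F : normedModType R) (A : bop E F) (B : bop F E) :=
  cancel A B /\ cancel B A.

Definition bop_iso (E F : normedModType R) (A : bop E F) :=
  exists B, bop_inverse A B.

Definition bop_inv (E F : normedModType R) (A : bop E F) : bop F E :=
  xget 0 (bop_inverse A).

End BoundedOperators.

Section Regularity.
Context {R : realType}.

(* [Ck] and [smooth] are only used on open sets. *)
Fixpoint Ck (k : nat) : forall E F : normedModType R, set E -> (E -> F) -> Prop :=
  match k with
  | 0 => fun E F U f => forall x, U x -> {for x, continuous f}
  | k'.+1 => fun E F U f => exists D : E -> bop E F,
      (forall x, U x -> is_diff x f (D x)) /\ Ck k' U D
  end.

Definition smooth (E F : normedModType R) (U : set E) (f : E -> F) :=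
  forall k, Ck k U f.

(* The C^(k,a) norm of [f] on [K] is at most [B]. *)
Fixpoint holder_le (k : nat) (a : R) :
    forall E F : normedModType R, set E -> (E -> F) -> R -> Prop :=
  match k with
  | 0 => fun E F K f B =>
      (forall x, K x -> `|f x| <= B) /\
      (forall x y, K x -> K y -> `|f x - f y| <= B * `|x - y| `^ a)
  | k'.+1 => fun E F K f B =>
      (forall x, K x -> `|f x| <= B) /\
      exists D : E -> bop E F,
        (forall x, K x -> is_diff x f (D x)) /\ holder_le k' a K D B
  end.

Definition holder_on (k : nat) (a : R) (E F : normedModType R) (U : set E)
    (f : E -> F) :=
  forall x, U x -> exists V B, [/\ open V, V x & holder_le k a V f B].

End Regularity.

Section Manifolds.
Context {R : realType}.

Record chart (T : topologicalType) (E : normedModType R) := Chart {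
  dom : set T;
  fwd :> T -> E;
  bwd : E -> T }.

Definition cod (T : topologicalType) (E : normedModType R) (c : chart T E) :
  set E := c @` dom c.

Definition is_chart (T : topologicalType) (E : normedModType R) (c : chart T E) :=
  [/\ open (dom c), open (cod c), (forall p, dom c p -> bwd c (c p) = p),
      (forall p, dom c p -> {for p, continuous c})
    & (forall x, cod c x -> {for x, continuous (bwd c)})].

(* Each point carries a preferred chart, and the tangent space at [p] is the
   model space [E], read in the chart [chart_at p]: tangent vectors, metrics and
   differentials at [p] are expressed in that chart. *)
Record manifold (E : normedModType R) := Manifold {
  point_of :> topologicalType;
  atlas : set (chart point_of E);
  chart_at : point_of -> chart point_of E;
  atlasP : forall c, atlas c -> is_chart c;
  chart_at_atlas : forall p, atlas (chart_at p);
  chart_at_dom : forall p, dom (chart_at p) p;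
  transition_smooth : forall c d, atlas c -> atlas d ->
    smooth [set x | cod c x /\ dom d (bwd c x)] (fun x => d (bwd c x)) }.

Definition fin_dim_manifold (n : nat) (M : manifold 'rV[R]_n) :=
  hausdorff_space M /\ @second_countable M.

Section Maps.
Context {E F : normedModType R} {M : manifold E} {N : manifold F}.

Definition expr (f : M -> N) (c : chart M E) (d : chart N F) : E -> F :=
  fun x => d (f (bwd c x)).

Definition expr_dom (f : M -> N) (c : chart M E) (d : chart N F) : set E :=
  [set x | cod c x /\ dom d (f (bwd c x))].

Definition map_smooth_on (V : set M) (f : M -> N) :=
  (forall p, V p -> {for p, continuous f}) /\
  forall c d, atlas c -> atlas d ->
    smooth (expr_dom f c d `&` bwd c @^-1` V) (expr f c d).

Definition map_smooth (f : M -> N) := map_smooth_on setT f.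

Definition map_holder (k : nat) (a : R) (f : M -> N) :=
  continuous f /\ forall c d, atlas c -> atlas d ->
    holder_on k a (expr_dom f c d) (expr f c d).

Definition tangent_map (f : M -> N) (p : M) : {linear E -> F} :=
  'd (expr f (chart_at p) (chart_at (f p))) (chart_at p p).

End Maps.

(* Differential at [p] of a map into a normed space. *)
Definition mdiff (E W : normedModType R) (M : manifold E) (f : M -> W) (p : M) :
    {linear E -> W} :=
  'd (fun x => f (bwd (chart_at p) x)) (chart_at p p).

Definition mdifferentiable (E W : normedModType R) (M : manifold E)
    (f : M -> W) (p : M) :=
  differentiable (fun x => f (bwd (chart_at p) x)) (chart_at p p).

Definition map2_smooth (E1 E2 F : normedModType R) (A : manifold E1)
    (B : manifold E2) (N : manifold F) (f : A -> B -> N) :=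
  continuous (fun z : A * B => f z.1 z.2) /\
  forall a b d, atlas a -> atlas b -> atlas d ->
    smooth [set z : E1 * E2 | [/\ cod a z.1, cod b z.2
              & dom d (f (bwd a z.1) (bwd b z.2))]]
           (fun z : E1 * E2 => d (f (bwd a z.1) (bwd b z.2))).

Definition curve_smooth (E : normedModType R) (M : manifold E) (u : R -> M) :=
  continuous u /\ forall c, atlas c -> smooth (u @^-1` dom c) (fun t => c (u t)).

Definition jac (n m : nat) (M : manifold 'rV[R]_n) (N : manifold 'rV[R]_m)
    (f : M -> N) (p : M) : 'M[R]_(n, m) :=
  lin1_mx (tangent_map f p).

End Manifolds.

Section Riemannian.
Context {R : realType}.

Definition partial (n : nat) (i : 'I_n) (u : 'rV[R]_n -> R) (x : 'rV[R]_n) : R :=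
  'D_(delta_mx 0 i) u x.

Definition christoffel (n : nat) (g : 'rV[R]_n -> 'M[R]_n) (k i j : 'I_n)
    (x : 'rV[R]_n) : R :=
  2^-1 * \sum_l invmx (g x) k l *
    (partial i (fun y => g y j l) x + partial j (fun y => g y i l) x
     - partial l (fun y => g y i j) x).

Definition ricci_coord (n : nat) (g : 'rV[R]_n -> 'M[R]_n) (i j : 'I_n)
    (x : 'rV[R]_n) : R :=
  let G := christoffel g in
  \sum_k (partial k (G k i j) x - partial j (G k i k) x)
  + \sum_k \sum_l (G k k l x * G l i j x - G k j l x * G l i k x).

Section Metric.
Context {n : nat} {M : manifold 'rV[R]_n}.

(* Gram matrices, at [p] in the chart [chart_at p]; row vector convention. *)
Definition metric_field := M -> 'M[R]_n.

Definition metric_expr (g : metric_field) (c : chart M 'rV[R]_n)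
    (x : 'rV[R]_n) : 'M[R]_n :=
  let p := bwd c x in
  let A := 'J (fun y => chart_at p (bwd c y)) x in
  A *m g p *m A^T.

Definition riemannian (g : metric_field) := forall p,
  (g p)^T = g p /\ forall v : 'rV[R]_n, v != 0 -> 0 < (v *m g p *m v^T) 0 0.

Definition metric_smooth (g : metric_field) := forall c, atlas c ->
  smooth (cod c) (metric_expr g c).

Definition metric_holder (k : nat) (a : R) (g : metric_field) :=
  forall c, atlas c -> holder_on k a (cod c) (metric_expr g c).

Definition ricci (g : metric_field) (p : M) : 'M[R]_n :=
  \matrix_(i, j) ricci_coord (metric_expr g (chart_at p)) i j (chart_at p p).

Definition einstein (lambda : R) (g : metric_field) :=
  forall p, ricci g p = lambda *: g p.

Definition velocity (u : R -> M) (t : R) : 'rV[R]_n :=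
  derive1 (fun s => chart_at (u t) (u s)) t.

Definition geodesic_at (g : metric_field) (u : R -> M) (t : R) :=
  let c := chart_at (u t) in
  let v := velocity u t in
  forall k, derive1n 2 (fun s => c (u s)) t 0 k
    + \sum_i \sum_j christoffel (metric_expr g c) k i j (c (u t))
                    * v 0 i * v 0 j = 0.

End Metric.

Definition tension (n m : nat) (M : manifold 'rV[R]_n) (N : manifold 'rV[R]_m)
    (h : @metric_field m N) (g : @metric_field n M) (f : M -> N) (p : M) :
    'rV[R]_m :=
  let c := chart_at p in
  let d := chart_at (f p) in
  let x := c p in
  let u b := fun y => expr f c d y 0 b in
  \row_b \sum_i \sum_j invmx (metric_expr g c x) i j *
    (partial i (partial j (u b)) x
     - \sum_k christoffel (metric_expr g c) k i j x * partial k (u b) x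
     + \sum_(a1 < m) \sum_(a2 < m)
         christoffel (metric_expr h d) b a1 a2 (d (f p))
         * partial i (u a1) x * partial j (u a2) x).

Definition harmonic_map (n m : nat) (M : manifold 'rV[R]_n) (N : manifold 'rV[R]_m)
    (h : @metric_field m N) (g : @metric_field n M) (f : M -> N) :=
  forall p, tension h g f p = 0.

End Riemannian.
Arguments metric_field {R n} M.

Section GroupActions.
Context {R : realType}.

Record lie_group (l : nat) := LieGroup {
  lie_manifold :> manifold 'rV[R]_l;
  lie_fin_dim : fin_dim_manifold lie_manifold;
  lie_mul : lie_manifold -> lie_manifold -> lie_manifold;
  lie_one : lie_manifold;
  lie_inv : lie_manifold -> lie_manifold;
  lie_mulA : associative lie_mul;
  lie_mul1 : left_id lie_one lie_mul;
  lie_mulV : left_inverse lie_one lie_inv lie_mul;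
  lie_mul_smooth : map2_smooth lie_mul;
  lie_inv_smooth : map_smooth lie_inv }.

Record smooth_action (l n : nat) (G : lie_group l) (M : manifold 'rV[R]_n) :=
  SmoothAction {
  act :> G -> M -> M;
  act1 : forall p, act (lie_one G) p = p;
  actM : forall a b p, act (lie_mul a b) p = act a (act b p);
  act_smooth : map2_smooth act }.

Section Action.
Context {l n : nat} {G : lie_group l} {M : manifold 'rV[R]_n}.
Variable A : smooth_action G M.

Definition invariant_metric (g : metric_field M) := forall a p,
  jac (A a) p *m g (A a p) *m (jac (A a) p)^T = g p.

(* The row space is the tangent space of the orbit through [p]. *)
Definition orbit_jac (p : M) : 'M[R]_(l, n) :=
  jac (fun a => A a p) (lie_one G).

(* [r] identifies the orbit space with [0, L]; as [M] is compact, the induced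
   continuous bijection from the quotient is a homeomorphism. *)
Record cohomogeneity_one (L : R) (r : M -> R) : Prop := {
  orbit_length_gt0 : 0 < L;
  orbit_map_continuous : continuous r;
  orbit_map_range : range r = [set` `[0, L]];
  orbit_mapP : forall p q, r p = r q <-> exists a, q = A a p;
  principal_orbit : forall p, 0 < r p < L -> (\rank (orbit_jac p)).+1 = n;
  singular_orbit : forall p, r p = 0 \/ r p = L -> ((\rank (orbit_jac p)).+1 < n)%N }.

(* [u] is a unit-speed geodesic of [g], orthogonal to the orbits, on [0, L]. *)
Definition normal_geodesic (L : R) (u : R -> M) (g : metric_field M) :=
  forall t, t \in `[0, L] ->
    let v := velocity u t in
    [/\ (v *m g (u t) *m v^T) 0 0 = 1,
        orbit_jac (u t) *m g (u t) *m v^T = 0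
      & geodesic_at g u t].

Definition normalized_metric (L : R) (u : R -> M) (g : metric_field M) :=
  [/\ riemannian g, invariant_metric g & normal_geodesic L u g].

(* The metrics are at least C^(k+1,a), so that the tension field of a
   C^(k+2,a) map is C^(k,a). *)
Definition metric_manifold (k : nat) (a L : R) (u : R -> M)
    (EG : normedModType R) (Gm : manifold EG) (met : Gm -> metric_field M) :=
  injective met /\ forall g,
    normalized_metric L u (met g) /\ metric_holder k.+1 a (met g).

End Action.

Definition einstein_family (n : nat) (M : manifold 'rV[R]_n) (lambda : R)
    (EG : normedModType R) (Gm : manifold EG) (met : Gm -> metric_field M)
    (dS : nat) (S : manifold 'rV[R]_dS) (gfam : S -> Gm) :=
  [/\ map_smooth gfam,
      forall p, einstein lambda (met (gfam p))
    & forall cS c, atlas cS -> atlas c ->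
        smooth [set z : 'rV[R]_dS * 'rV[R]_n | cod cS z.1 /\ cod c z.2]
          (fun z => metric_expr (met (gfam (bwd cS z.1))) c z.2)].

End GroupActions.

Section MappingSpaces.
Context {R : realType} {l n m : nat} {G : @lie_group R l}.
Context {M : manifold 'rV[R]_n} {N : manifold 'rV[R]_m}.
Variables (aM : smooth_action G M) (aN : smooth_action G N).

Definition equivariant (f : M -> N) := forall a p, f (aM a p) = aN a (f p).

Definition equivariantly_homotopic (f0 f1 : M -> N) :=
  exists H : R -> M -> N,
    [/\ continuous (fun z : R * M => H z.1 z.2),
        (forall t, equivariant (H t)), H 0 = f0 & H 1 = f1].

Definition constrained_maps (k : nat) (a : R) (ref : M -> N)
    (P : set (M -> N)) : set (M -> N) :=
  [set f | [/\ map_holder k a f, equivariant f,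
               equivariantly_homotopic ref f & P f]].

Definition window := (chart M 'rV[R]_n * chart N 'rV[R]_m * set 'rV[R]_n)%type.

Definition window_for (f : M -> N) (w : window) :=
  [/\ atlas w.1.1, atlas w.1.2, compact w.2
    & w.2 `<=` expr_dom f w.1.1 w.1.2].

Definition holder_close (k : nat) (a : R) (f : M -> N) (w : window) (e : R)
    (f' : M -> N) :=
  w.2 `<=` expr_dom f' w.1.1 w.1.2 /\
  holder_le k a w.2
    (fun x => expr f' w.1.1 w.1.2 x - expr f w.1.1 w.1.2 x) e.

(* The Banach manifold [H] is the set [C] of maps, with its C^(k,a) topology. *)
Definition mapping_manifold (k : nat) (a : R) (C : set (M -> N))
    (EH : normedModType R) (H : manifold EH) (ev : H -> M -> N) :=
  [/\ injective ev, range ev = C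
    & forall U : set H, open U <-> forall f, U f ->
        exists q (w : 'I_q -> window) (e : R),
          [/\ 0 < e, (forall i, window_for (ev f) (w i))
            & forall f', (forall i, holder_close k a (ev f) (w i) e (ev f')) ->
                U f']].

(* A section of the pullback of TN by [f] is a map [s] whose value [s p] is a
   tangent vector at [f p], read in the chart [chart_at (f p)]. *)
Definition section_expr (f : M -> N) (s : M -> 'rV[R]_m) (c : chart M 'rV[R]_n)
    (d : chart N 'rV[R]_m) (x : 'rV[R]_n) : 'rV[R]_m :=
  let p := bwd c x in
  let e := chart_at (f p) in
  'd (fun y => d (bwd e y)) (e (f p)) (s p).

Definition section_fibre (k : nat) (a : R) (f : M -> N) :
    set (M -> 'rV[R]_m) :=
  [set s | (forall c d, atlas c -> atlas d ->
              holder_on k a (expr_dom f c d) (section_expr f s c d)) /\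
           (forall b p, s (aM b p) = tangent_map (aN b) (f p) (s p))].

Record local_triv (H : topologicalType) (EY : normedModType R) := LocalTriv {
  tdom : set H;
  tmap : H -> EY -> M -> 'rV[R]_m;
  tinv : H -> (M -> 'rV[R]_m) -> EY }.

(* Over its domain, a local trivialization is a linear homeomorphism from [EY]
   onto the fibre, the latter with its C^(k,a) norm. *)
Definition is_local_triv (k : nat) (a : R) (H : topologicalType)
    (ev : H -> M -> N) (EY : normedModType R) (t : local_triv H EY) :=
  open (tdom t) /\ forall f, tdom t f ->
    [/\ linear (tmap t f), range (tmap t f) = section_fibre k a (ev f),
        cancel (tmap t f) (tinv t f),
        (forall w, window_for (ev f) w -> exists B, forall y,
           holder_le k a w.2 (section_expr (ev f) (tmap t f y) w.1.1 w.1.2)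
             (B * `|y|))
      & (exists q (w : 'I_q -> window) B,
           (forall i, window_for (ev f) (w i)) /\
           forall y b, 0 <= b ->
             (forall i, holder_le k a (w i).2
                (section_expr (ev f) (tmap t f y) (w i).1.1 (w i).1.2) b) ->
             `|y| <= B * b)].

Definition section_bundle (k : nat) (a : R) (EH : normedModType R)
    (H : manifold EH) (ev : H -> M -> N) (EY : normedModType R)
    (Y : set (local_triv H EY)) :=
  [/\ forall t, Y t -> is_local_triv k a ev t,
      forall f, exists2 t, Y t & tdom t f
    & forall t t' c, Y t -> Y t' -> atlas c ->
        exists T : EH -> bop EY EY,
          let D := [set x | [/\ cod c x, tdom t (bwd c x) & tdom t' (bwd c x)]] in
          smooth D T /\
          forall x y, D x -> T x y = tinv t' (bwd c x) (tmap t (bwd c x) y)].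

End MappingSpaces.
Arguments local_triv {R n} m M H EY.

Section JacobiResponse.
Context {R : realType} {n m : nat}.
Context {M : manifold 'rV[R]_n} {N : manifold 'rV[R]_m}.
Context {EG EH EY : completeNormedModType R}.
Context {Gm : manifold EG} {H : manifold EH}.
Variables (h : metric_field N) (met : Gm -> metric_field M) (ev : H -> M -> N).

Section LocalExpressions.
Variables (cG : chart Gm EG) (cH : chart H EH) (t : local_triv m M H EY).

(* The tension field as a section of the bundle over the product, read in a
   chart of metrics, a chart of maps and a trivialization of the bundle. *)
Definition tension_loc (x : EG) (y : EH) : EY :=
  tinv t (bwd cH y) (tension h (met (bwd cG x)) (ev (bwd cH y))).

Definition jacobi_loc (x : EG) (y : EH) : bop EH EY :=
  to_bop ('d (tension_loc x) y).

Definition jacobi (g : Gm) (f : H) : bop EH EY := jacobi_loc (cG g) (cH f).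

Context {ES : normedModType R} {S : manifold ES}.
Variables (gfam : S -> Gm) (Pi : S -> H) (p0 : S).

Definition jacobi_at (p : S) : bop EH EY := jacobi (gfam p) (Pi p).

Definition green_at (p : S) : bop EY EH := bop_inv (jacobi_at p).

Definition core_package (p : S) : bop EH EY * bop EY EH :=
  (jacobi_at p, green_at p).

Definition response_differential : ES -> bop EH EY * bop EY EH :=
  mdiff core_package p0.

Definition metric_variation (X : ES) : EG := mdiff (fun p => cG (gfam p)) p0 X.

Definition map_variation (X : ES) : EH := mdiff (fun p => cH (Pi p)) p0 X.

Definition forcing (X : ES) : EY :=
  'd (tension_loc ^~ (cH (Pi p0))) (cG (gfam p0)) (metric_variation X).

Definition jacobi_response (X : ES) : bop EH EY := mdiff jacobi_at p0 X.

Definition jacobi_dg (x : EG) : bop EH EY :=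
  'd (jacobi_loc ^~ (cH (Pi p0))) (cG (gfam p0)) x.

Definition jacobi_df (y : EH) : bop EH EY :=
  'd (jacobi_loc (cG (gfam p0))) (cH (Pi p0)) y.

Definition infinitesimally_complete := injective response_differential.

(* The branch of harmonic maps given by the implicit function theorem, on a
   neighbourhood [V] of [p0] over which the local expressions are defined. *)
Record implicit_branch (V : set S) : Prop := {
  branch_open : open V;
  branch_base : V p0;
  branch_smooth : map_smooth_on V Pi;
  branch_harmonic : forall p, V p -> harmonic_map h (met (gfam p)) (ev (Pi p));
  branch_local : forall p, V p ->
    [/\ dom cG (gfam p), dom cH (Pi p) & tdom t (Pi p)];
  branch_iso : forall p, V p -> bop_iso (jacobi_at p) }.

End LocalExpressions.

Definition tension_smooth (Y : set (local_triv m M H EY)) :=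
  forall cG cH t, atlas cG -> atlas cH -> Y t ->
    smooth [set z : EG * EH | [/\ cod cG z.1, cod cH z.2 & tdom t (bwd cH z.2)]]
           (fun z : EG * EH => tension_loc cG cH t z.1 z.2).

End JacobiResponse.

(* Main.v *)
From HB Require Import structures.
Require Import Defs.
From mathcomp Require Import all_boot all_order all_algebra.
From mathcomp Require Import all_classical all_reals all_analysis.
From mathcomp Require Import ring.
Set Implicit Arguments.
Unset Strict Implicit.
Unset Printing Implicit Defensive.
Import Order.TTheory GRing.Theory Num.Theory.
Import numFieldNormedType.Exports.
Local Open Scope classical_set_scope.
Local Open Scope ring_scope.

(* Read in charts and in the trivialization, the tension field is a C^2 map
   F(x, y) near (x(p0), y(p0)), with J = D_y F and F(x(p), y(p)) = 0 along the
   branch. Differentiating the last equation gives D_x F[h_X] + J_0[fdot_X] = 0,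
   hence fdot_X = - G_0 K_0[X]; the chain rule applied to J(x(p), y(p)) gives
   the formula for the response. For the inverses,
   G_p - G_0 = - G_p (J_p - J_0) G_0: this bounds G_p near p0, shows its
   continuity there, and yields the derivative - G_0 JJ(X) G_0. The second
   component of the differential is thus a function of the first, so that the
   kernels agree. *)

(** * Bounded operators, their norm and composition *)

Section BoundedOperatorCalculus.
Context {R : realType}.
Implicit Types E F G W : normedModType R.

Lemma to_bopE E F (f : E -> F) : linear f -> continuous f -> to_bop f = f :> (E -> F).
Proof. by move=> lf cf; rewrite /to_bop insubdK//; apply/asboolP. Qed.

(** [to_bop] falls back to [0] on a map that is not linear and continuous; differentiability
    supplies the continuity of ['d f x]. *)
Lemma diff_bopE E F (f : E -> F) x : differentiable f x ->
  to_bop ('d f x) = 'd f x :> (E -> F).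
Proof.
by move=> df; apply: to_bopE; [exact: linearP|exact: diff_continuous].
Qed.

Lemma bopP E F (A B : bop E F) : A =1 B -> A = B.
Proof. by move=> AB; apply/val_inj/funext. Qed.

Lemma bop_norm E F (A : bop E F) x : `|A x| <= `|A| * `|x|.
Proof. exact: opnormP. Qed.

Lemma bop_norm_le E F (A : bop E F) C :
  0 <= C -> (forall x, `|A x| <= C * `|x|) -> `|A| <= C.
Proof. exact: opnorm_le. Qed.

Lemma bop_comp_norm E F G (A : bop F G) (B : bop E F) :
  `|bop_comp A B| <= `|A| * `|B|.
Proof.
apply: bop_norm_le => [|x]; first by rewrite mulr_ge0.
by rewrite /= (le_trans (bop_norm _ _))// -mulrA ler_wpM2l// bop_norm.
Qed.

Lemma linear_bound_continuous E F (f : E -> F) C : linear f ->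
  (forall x, `|f x| <= C * `|x|) -> continuous f.
Proof.
move=> lf fC; pose fL := GRing.isLinear.Build _ _ _ _ _ lf.
pose g : {linear E -> F} := HB.pack f fL.
apply: (@bounded_linear_continuous _ _ _ g); apply/linear_boundedP.
near=> r => x; apply: (le_trans (fC x)); apply: ler_wpM2r => //.
Unshelve. all: by end_near. Qed.

Lemma bop_precomp_linear E F G (B : bop E F) :
  linear (fun A : bop F G => bop_comp A B).
Proof. by move=> a A A'; apply: bopP. Qed.

Lemma bop_precomp_continuous E F G (B : bop E F) :
  continuous (fun A : bop F G => bop_comp A B).
Proof.
apply: (@linear_bound_continuous _ _ _ `|B|); first exact: bop_precomp_linear.
by move=> A; rewrite mulrC; exact: bop_comp_norm.
Qed.

Lemma bop_postcomp_linear E F G (B : bop F G) :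
  linear (fun A : bop E F => bop_comp B A).
Proof. by move=> a A A'; apply: bopP => x; exact: linearP. Qed.

(** * Differentials as bounded operators *)

Lemma is_diff_linear E F (f : E -> F) x : linear f -> continuous f -> is_diff x f f.
Proof.
move=> lf cf; pose fL := GRing.isLinear.Build _ _ _ _ _ lf.
pose g : {linear E -> F} := HB.pack f fL.
by apply: DiffDef; [exact: (@linear_differentiable _ _ _ g)|exact: (@diff_lin _ _ _ g)].
Qed.

(** Uniqueness of the differential requires a continuous candidate, which the type [bop] guarantees.
    The explicit estimate is the form in which the inverse is differentiated below. *)
Lemma is_diff_bopP E F (f : E -> F) x (A : bop E F) :
  is_diff x f A <->
  forall e, 0 < e -> \forall y \near (0 : E), `|f (y + x) - f x - A y| <= e * `|y|.
Proof.
split=> [[df Adf] e e0|fA].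
  have /diff_locally /eqaddoP /(_ _ e0) := df.
  by apply: filterS => y /=; rewrite !fctE /= Adf opprD addrA.
have fx : f \o shift x = cst (f x) + (A : E -> F) +o_ 0 id.
  apply/eqaddoP => e e0; near=> y => /=.
  by rewrite !fctE /= opprD addrA; near: y; exact: fA.
have dA : 'd f x = A :> (E -> F).
  by apply: (@diff_unique _ _ _ f A x) fx; exact: bop_continuous.
by split=> //; apply/diff_locallyP; rewrite dA; split=> //; exact: bop_continuous.
Unshelve. all: by end_near. Qed.

(** Differentiation is local. This allows formulas valid only near the base point, where charts and
    [to_bop] are meaningful. *)
Lemma is_diff_near E F (f g : E -> F) (df : E -> F) x :
  (\forall y \near x, f y = g y) -> is_diff x f df -> is_diff x g df.
Proof.
move=> fg fdf; have dfE : to_bop ('d f x) = df :> (E -> F).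
  by rewrite diff_bopE ?diff_val//; exact: ex_diff.
move: fdf; rewrite -dfE => /is_diff_bopP fdf; apply/is_diff_bopP => e e0.
have fg0 : \forall y \near (0 : E), f (y + x) = g (y + x).
  by move: fg; rewrite (near_shift 0)/=; apply: filterS => y /=; rewrite subr0.
near=> y.
rewrite -(nbhs_singleton fg) -(near fg0 y)//; near: y; exact: fdf.
Unshelve. all: by end_near. Qed.

Lemma is_diff_pair_l E F G (f : E * F -> G) df x y :
  is_diff (x, y) f df -> is_diff x (fun z => f (z, y)) (fun v => df (v, 0)).
Proof.
move=> fdf; have := @is_diff_comp _ _ _ _ _ _ _ _ x
  (is_diff_pair (is_diff_id x) (is_diff_cst y x)) fdf.
by [].
Qed.

Lemma is_diff_pair_r E F G (f : E * F -> G) df x y :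
  is_diff (x, y) f df -> is_diff y (fun z => f (x, z)) (fun v => df (0, v)).
Proof.
move=> fdf; have := @is_diff_comp _ _ _ _ _ _ _ _ y
  (is_diff_pair (is_diff_cst x y) (is_diff_id y)) fdf.
by [].
Qed.

(** * Inverse operators and their derivative *)

Lemma bop_inv_inverse E F (A : bop E F) : bop_iso A -> bop_inverse A (bop_inv A).
Proof. by move=> [B AB]; exact: (xgetI _ AB). Qed.

(** Resolvent identity: since [T A = 1] and [B S = 1], [B - A = B T A - B S A]. *)
Lemma bop_inverse_sub E F (T S : bop E F) (A B : bop F E) :
  bop_inverse T A -> bop_inverse S B ->
  B - A = - bop_comp B (bop_comp (S - T) A).
Proof.
move=> [_ TA] [SB _]; apply: bopP => x.
rewrite -[LHS]/(B x - A x) -[RHS]/(- B (S (A x) - T (A x))).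
by rewrite TA linearB /= SB opprB.
Qed.

(* [B = A - B (S - T) A], so [|B| <= |A| + |B| / 2]. *)
Lemma bop_inverse_norm_le E F (T S : bop E F) (A B : bop F E) :
  bop_inverse T A -> bop_inverse S B ->
  `|S - T| * `|A| <= 2^-1 -> `|B| <= 2 * `|A|.
Proof.
move=> TA SB h; have BA : `|B - A| <= `|B| * 2^-1.
  rewrite (bop_inverse_sub TA SB) normrN (le_trans (bop_comp_norm _ _))//.
  by rewrite ler_wpM2l// (le_trans (bop_comp_norm _ _)).
have := le_trans (lerB_dist B A) BA.
by rewrite lerBlDr -lerBlDl {1}(splitr `|B|) addrK ler_pdivrMr// mulrC.
Qed.

(** Invertibility near [s] is given, so the resolvent identity applies at every nearby point. The
    remainder splits into a term quadratic in the increment of [J] and one carrying the remainder of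
    [J]. *)
Lemma is_diff_bop_inv W E F (J : W -> bop E F) (dJ : W -> bop E F) (s : W) :
  is_diff s J dJ -> (\forall w \near s, bop_iso (J w)) ->
  is_diff s (fun w => bop_inv (J w))
    (fun v => - bop_comp (bop_inv (J s)) (bop_comp (dJ v) (bop_inv (J s)))).
Proof.
move=> JdJ Jiso; have Js : differentiable J s by exact: ex_diff.
set A := to_bop ('d J s); have AE : A = dJ :> (W -> _).
  by rewrite /A diff_bopE// diff_val.
move: JdJ; rewrite -AE => /is_diff_bopP JA; set G0 := bop_inv (J s).
have G0P : bop_inverse (J s) G0.
  by apply: bop_inv_inverse; exact: (nbhs_singleton Jiso).
have lA' : linear (fun v => - bop_comp G0 (bop_comp (A v) G0)).
  move=> a v w; rewrite [A _]linearP bop_precomp_linear bop_postcomp_linear.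
  by rewrite opprD scalerN.
have cA' : continuous (fun v => - bop_comp G0 (bop_comp (A v) G0)).
  apply: (@linear_bound_continuous _ _ _ (`|G0| * (`|A| * `|G0|))) => // v.
  rewrite normrN (le_trans (bop_comp_norm _ _))// -mulrA ler_wpM2l//.
  by rewrite (le_trans (bop_comp_norm _ _))// mulrAC ler_wpM2r// bop_norm.
suff : is_diff s (fun w => bop_inv (J w))
    (to_bop (fun v => - bop_comp G0 (bop_comp (A v) G0))) by rewrite to_bopE.
apply/is_diff_bopP => e e0; rewrite to_bopE//.
(* [K] is a Lipschitz constant at [s]: the remainder of [J] at precision 1 gives
   [|J (y + s) - J s| <= (1 + |A|) |y|]. *)
set C := `|G0|; set K := 1 + `|A|.
have C0 : 0 <= C by exact: normr_ge0.
have K0 : 0 < K by rewrite ltr_pwDl ?normr_ge0.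
have near_shift_s (Q : W -> Prop) :
    (\forall w \near s, Q w) -> \forall y \near (0 : W), Q (y + s).
  by rewrite (near_shift 0)/=; apply: filterS => y /=; rewrite subr0.
have Jc d : 0 < d -> \forall y \near (0 : W), `|J (y + s) - J s| <= d.
  move=> d0; apply: (near_shift_s (fun w => `|J w - J s| <= d)).
  have /cvgrPdist_le Jd := differentiable_continuous Js; have := Jd _ d0.
  by apply: filterS => w; rewrite distrC.
(* Chosen so that [2 C^3 K d <= e / 2] and [C^2 e' <= e / 2], one half of the error for each term;
   the added 1 keeps the denominators positive when [C = 0]. *)
pose d := e / 2 / (2 * C ^+ 3 * K + 1).
have d0 : 0 < d by rewrite !divr_gt0// ltr_wpDl// !mulr_ge0// ?exprn_ge0// ltW.
pose e' := e / 2 / (C ^+ 2 + 1).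
have e'0 : 0 < e' by rewrite !divr_gt0// ltr_wpDl// exprn_ge0.
(* An increment of [J] of at most this size, multiplied by [C], stays below the threshold 1/2 of
   [bop_inverse_norm_le]. *)
have r0 : 0 < 2^-1 / (C + 1) by rewrite divr_gt0 ?invr_gt0// ltr_wpDl.
near=> y.
have isoy : bop_iso (J (y + s)) by near: y; exact: (near_shift_s (fun w => bop_iso (J w))).
set G1 := bop_inv (J (y + s)); have G1P := bop_inv_inverse isoy : bop_inverse _ G1.
have Td : `|J (y + s) - J s| <= d by near: y; exact: Jc.
have Tr : `|J (y + s) - J s| <= 2^-1 / (C + 1) by near: y; exact: Jc.
have TA1 : `|J (y + s) - J s - A y| <= 1 * `|y| by near: y; exact: JA.
have TAe : `|J (y + s) - J s - A y| <= e' * `|y| by near: y; exact: JA.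
set T := J (y + s) - J s in Td Tr TA1 TAe *.
have TK : `|T| <= K * `|y|.
  rewrite -[T](subrK (A y)) (le_trans (ler_normD _ _))// mulrDl lerD//.
  exact: bop_norm.
have G1C : `|G1| <= 2 * C.
  apply: (bop_inverse_norm_le G0P G1P).
  rewrite (le_trans (ler_wpM2r _ Tr))// -mulrA ler_piMr// mulrC.
  by rewrite ler_pdivrMr ?mul1r ?lerDl// ltr_wpDl.
have GG : `|G1 - G0| <= 2 * C * (`|T| * C).
  rewrite (bop_inverse_sub G0P G1P) normrN (le_trans (bop_comp_norm _ _))//.
  by rewrite ler_pM// bop_comp_norm.
(* Substitute [G1 - G0 = - G1 T G0], then add and subtract [G0 T G0]. *)
have -> : G1 - G0 - - bop_comp G0 (bop_comp (A y) G0) =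
    bop_comp (G0 - G1) (bop_comp T G0) - bop_comp G0 (bop_comp (T - A y) G0).
  rewrite (bop_inverse_sub G0P G1P); apply: bopP => x; rewrite -/T.
  rewrite -[LHS]/(- G1 (T (G0 x)) - - G0 (A y (G0 x))).
  rewrite -[RHS]/(G0 (T (G0 x)) - G1 (T (G0 x)) - G0 (T (G0 x) - A y (G0 x))).
  have -> : G0 (T (G0 x) - A y (G0 x)) = G0 (T (G0 x)) - G0 (A y (G0 x)).
    exact: linearB.
  by rewrite opprB opprK [RHS]addrC addrA subrK addrC.
rewrite (le_trans (ler_normB _ _))//.
have b1 : `|bop_comp (G0 - G1) (bop_comp T G0)| <= e / 2 * `|y|.
  rewrite (le_trans (bop_comp_norm _ _))// distrC.
  have h1 : `|bop_comp T G0| <= `|T| * C by exact: bop_comp_norm.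
  apply: (le_trans (ler_pM _ _ GG h1)) => //.
  have -> : 2 * C * (`|T| * C) * (`|T| * C) = 2 * C ^+ 3 * (`|T| * `|T|) by ring.
  (* One factor is made small by continuity, the other is linear in [y]. *)
  have h2 : `|T| * `|T| <= d * (K * `|y|) by exact: ler_pM.
  apply: (le_trans (ler_wpM2l _ h2)); first by rewrite mulr_ge0// exprn_ge0.
  have -> : 2 * C ^+ 3 * (d * (K * `|y|)) = (2 * C ^+ 3 * K * d) * `|y| by ring.
  rewrite ler_wpM2r// /d mulrCA ler_piMr ?divr_ge0 ?ltW//.
  by rewrite ltr_pdivrMr ?mul1r ?ltrDl// ltr_wpDl// !mulr_ge0 ?exprn_ge0// ltW.
have b2 : `|bop_comp G0 (bop_comp (T - A y) G0)| <= e / 2 * `|y|.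
  rewrite (le_trans (bop_comp_norm _ _))//.
  have h1 : `|bop_comp (T - A y) G0| <= (e' * `|y|) * C.
    by rewrite (le_trans (bop_comp_norm _ _))// ler_wpM2r.
  apply: (le_trans (ler_wpM2l _ h1)) => //.
  rewrite -/C; have -> : C * (e' * `|y| * C) = (C ^+ 2 * e') * `|y| by ring.
  rewrite ler_wpM2r// /e' mulrCA ler_piMr ?divr_ge0 ?ltW//.
  by rewrite ltr_pdivrMr ?mul1r ?ltrDl// ltr_wpDl// exprn_ge0.
by rewrite (le_trans (lerD b1 b2))// -mulrDl -splitr.
Unshelve. all: by end_near. Qed.

(** * Partial differentials of maps of two variables *)

Lemma diff_prodE E F G (f : E -> F -> G) x y u v :
  differentiable (fun z : E * F => f z.1 z.2) (x, y) ->
  'd (fun z : E * F => f z.1 z.2) (x, y) (u, v) =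
  'd (f ^~ y) x u + 'd (f x) y v.
Proof.
move=> /differentiableP df.
have -> : (u, v) = (u, 0) + (0, v) :> E * F by apply/pair_equal_spec; rewrite addr0 add0r.
have dl := is_diff_pair_l df; have dr := is_diff_pair_r df.
by rewrite linearD -[in RHS]/(f^~ y) (@diff_val _ _ _ _ _ _ _ dl) (@diff_val _ _ _ _ _ _ _ dr).
Qed.

(** Serves twice: for the Jacobi operator along the branch, giving the response formula, and for the
    tension field, giving the linearized equation. *)
Lemma is_diff_prod_comp W E F G (f : E -> F -> G) (x : W -> E) (y : W -> F) (s : W) :
  differentiable (fun z : E * F => f z.1 z.2) (x s, y s) ->
  differentiable x s -> differentiable y s ->
  is_diff s (fun w => f (x w) (y w))
    (fun X => 'd (f ^~ (y s)) (x s) ('d x s X) + 'd (f (x s)) (y s) ('d y s X)).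
Proof.
move=> df /differentiableP dx /differentiableP dy.
have := @is_diff_comp _ _ _ _ _ _ _ _ s (is_diff_pair dx dy) (differentiableP df).
by move=> /is_diff_eq; apply; apply/funext => X /=; rewrite diff_prodE.
Qed.

(** On [U] the partial differential is the full one composed with the inclusion [v |-> (0, v)].
    Precomposition is bounded and linear, so [J] inherits joint differentiability from [D]. *)
Lemma differentiable_diff_r E F G (f : E -> F -> G) (U : set (E * F)) x y :
  nbhs (x, y) U -> Ck 2 U (fun z : E * F => f z.1 z.2) ->
  let J a b : bop F G := to_bop ('d (f a) b) in
  differentiable (fun z : E * F => f z.1 z.2) (x, y) /\
  differentiable (fun z : E * F => J z.1 z.2) (x, y).
Proof.
move=> Uxy [D [fD [D2 [DD2 _]]]] J; have Uz := nbhs_singleton Uxy.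
split; first exact: (@ex_diff _ _ _ _ _ _ _ (fD _ Uz)).
pose i (v : F) : E * F := (0, v).
have li : linear i by move=> b v w; rewrite -[RHS]/(b *: 0 + 0, b *: v + w) scaler0 addr0.
have ci : continuous i.
  by move=> v; apply: cvg_pair; [exact: cvg_cst|exact: cvg_id].
have Di := @is_diff_comp _ _ _ _ _ _ _ _ (x, y) (DD2 _ Uz)
  (is_diff_linear (D (x, y)) (@bop_precomp_linear _ _ G (to_bop i))
    (@bop_precomp_continuous _ _ G (to_bop i))).
suff H : is_diff (x, y) (fun z : E * F => J z.1 z.2)
    ((fun A : bop (E * F)%type G => bop_comp A (to_bop i)) \o D2 (x, y)).
  by exact: (@ex_diff _ _ _ _ _ _ _ H).
apply: is_diff_near Di.
apply: filterS Uxy => -[a b] /fD /is_diff_pair_r Db; have db : differentiable (f a) b.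
  exact: (@ex_diff _ _ _ _ _ _ _ Db).
apply: bopP => v; rewrite /J diff_bopE// (@diff_val _ _ _ _ _ _ _ Db) /=.
by rewrite to_bopE.
Qed.

End BoundedOperatorCalculus.

(** * The response differential of the core package *)

Theorem theorem5p24 (R : realType)
  (* the cohomogeneity-one manifold and its normal geodesic *)
  (l n : nat) (G : @lie_group R l) (M : manifold 'rV[R]_n)
  (aM : smooth_action G M) (L : R) (r : M -> R) (u : R -> M)
  (M_fd : fin_dim_manifold M) (M_compact : compact [set: M])
  (M_cohom1 : cohomogeneity_one aM L r)
  (u_smooth : curve_smooth u) (u_orbit : forall s : R, s \in `[0, L] -> r (u s) = s)
  (* the target and the constraints on maps *)
  (m : nat) (N : manifold 'rV[R]_m) (aN : smooth_action G N) (h : metric_field N)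
  (N_fd : fin_dim_manifold N) (N_compact : compact [set: N])
  (h_riem : riemannian h) (h_smooth : metric_smooth h)
  (h_inv : invariant_metric aN h)
  (P : set (M -> N))
  (k : nat) (a : R) (k_ge4 : (4 <= k)%N) (a_gt0 : 0 < a) (a_lt1 : a < 1)
  (* the Banach manifolds of metrics and of maps, the bundle of sections *)
  (EG EH EY : completeNormedModType R)
  (Gm : manifold EG) (met : Gm -> metric_field M)
  (Gm_metrics : metric_manifold aM k a L u met)
  (H : manifold EH) (ev : H -> M -> N) (f0 : H)
  (H_maps : mapping_manifold k.+2 a
    (constrained_maps aM aN k.+2 a (ev f0) P) ev)
  (Y : set (local_triv m M H EY)) (Y_bundle : section_bundle aM aN k a ev Y)
  (F_smooth : tension_smooth h met ev Y)
  (* the Einstein family and the reference harmonic map *)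
  (dS : nat) (S : manifold 'rV[R]_dS) (S_fd : fin_dim_manifold S)
  (lambda : R) (lambda_gt0 : 0 < lambda)
  (gfam : S -> Gm) (g_einstein : einstein_family lambda met gfam) (p0 : S)
  (f0_harmonic : harmonic_map h (met (gfam p0)) (ev f0))
  (* the fixed local trivializations *)
  (cG : chart Gm EG) (cG_atlas : atlas cG) (cG_dom : dom cG (gfam p0))
  (cH : chart H EH) (cH_atlas : atlas cH) (cH_dom : dom cH f0)
  (t : local_triv m M H EY) (t_bundle : Y t) (t_dom : tdom t f0)
  (* nondegeneracy and the branch of harmonic maps it provides *)
  (J0_iso : bop_iso (jacobi h met ev cG cH t (gfam p0) f0))
  (Pi : S -> H) (Pi_p0 : Pi p0 = f0) (V : set S)
  (Pi_branch : implicit_branch h met ev cG cH t gfam Pi p0 V) :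
  let D := response_differential h met ev cG cH t gfam Pi p0 in
  let JJ := jacobi_response h met ev cG cH t gfam Pi p0 in
  let G0 := green_at h met ev cG cH t gfam Pi p0 in
  let K0 := forcing h met ev cG cH t gfam Pi p0 in
  let hdot := metric_variation cG gfam p0 in
  let fdot := map_variation cH Pi p0 in
  let DgJ := jacobi_dg h met ev cG cH t gfam Pi p0 in
  let DfJ := jacobi_df h met ev cG cH t gfam Pi p0 in
  [/\ mdifferentiable (core_package h met ev cG cH t gfam Pi) p0,
      (forall X, fdot X = - G0 (K0 X) /\ JJ X = DgJ (hdot X) + DfJ (fdot X)),
      (forall X, D X = (JJ X, - bop_comp G0 (bop_comp (JJ X) G0))),
      [set X | D X = 0] = [set X | JJ X = 0]
    & infinitesimally_complete h met ev cG cH t gfam Pi p0 <-> injective JJ].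
Proof.
set c := chart_at p0; set q := c p0.
have ca : atlas c := chart_at_atlas p0.
have p0c : dom c p0 := chart_at_dom p0.
have [_ c_open cK _ c_cont] := atlasP ca.
have cq : bwd c q = p0 := cK _ p0c.
have q_cod : cod c q by exists p0.
have [V_open Vp0 [_ Pi_smooth] Pi_harm V_dom V_iso] := Pi_branch.
have [[_ g_smooth] _ _] := g_einstein.
have [_ cG_open cGK _ _] := atlasP cG_atlas.
have [_ cH_open cHK _ cH_cont] := atlasP cH_atlas.
have [Y_triv _ _] := Y_bundle.
have [t_open tP] := Y_triv _ t_bundle.
(* Coordinate expressions of the family and of the branch in the chart [c], the one in which [mdiff]
   at [p0] is computed. *)
pose x z : EG := cG (gfam (bwd c z)).
pose y z : EH := cH (Pi (bwd c z)).
have xq : x q = cG (gfam p0) by rewrite /x cq.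
have yq : y q = cH (Pi p0) by rewrite /y cq.
have nearV : \forall z \near q, V (bwd c z).
  by apply: (c_cont _ q_cod); rewrite cq; exact: open_nbhs_nbhs.
have dx : differentiable x q.
  have [D [xD _]] := g_smooth c cG ca cG_atlas 1%N.
  apply: (@ex_diff _ _ _ _ _ _ _ (xD q _)).
  by split; [split=> //; rewrite cq|].
have dy : differentiable y q.
  have [D [yD _]] := Pi_smooth c cH ca cH_atlas 1%N.
  apply: (@ex_diff _ _ _ _ _ _ _ (yD q _)).
  by split; [split=> //; rewrite cq Pi_p0|rewrite /= cq].
have bHy : bwd cH (y q) = f0 by rewrite yq Pi_p0 cHK.
have y_cod : cod cH (y q) by rewrite yq Pi_p0; exists f0.
pose U := [set z : EG * EH | [/\ cod cG z.1, cod cH z.2 & tdom t (bwd cH z.2)]].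
have nearU : nbhs (x q, y q) U.
  exists (cod cG, cod cH `&` bwd cH @^-1` tdom t) => /=.
    split.
      by apply: open_nbhs_nbhs; split=> //; rewrite xq; exists (gfam p0).
    apply: filterI; first exact: open_nbhs_nbhs.
    by apply: (cH_cont _ y_cod); rewrite bHy; exact: open_nbhs_nbhs.
  by case=> e f [/= ? []].
pose F := tension_loc h met ev cG cH t.
pose J := jacobi_loc h met ev cG cH t.
have [dF dJ] : differentiable (fun z : EG * EH => F z.1 z.2) (x q, y q) /\
    differentiable (fun z : EG * EH => J z.1 z.2) (x q, y q).
  have [dF dJ] := differentiable_diff_r nearU
    (* Order 2: one derivative defines [J], the second differentiates it. *)
    (F_smooth _ _ _ cG_atlas cH_atlas t_bundle 2).
  by split; [exact: dF|exact: dJ].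
have JD := is_diff_prod_comp dJ dx dy.
have FD := is_diff_prod_comp dF dx dy.
have F0 : \forall z \near q, F (x z) (y z) = 0.
  apply: filterS nearV => z Vz; have [zG zH zt] := V_dom _ Vz.
  have [tlin _ tK _ _] := tP _ zt.
  rewrite /F /tension_loc /x /y cGK// cHK//.
  (* Linearity is known for [tmap], not for [tinv]: the zero section is therefore written as the
     image of [0], which [tinv] then cancels. *)
  have -> : tension h (met (gfam (bwd c z))) (ev (Pi (bwd c z))) =
      tmap t (Pi (bwd c z)) 0.
    have := tlin (-1) 0 0; rewrite scaler0 addr0 scaleN1r addNr => ->.
    by apply/funext => p; rewrite Pi_harm.
  exact: tK.
have Jq : J (x q) (y q) = jacobi_at h met ev cG cH t gfam Pi p0 by rewrite xq yq.
have JdJ : is_diff q (fun z => jacobi_at h met ev cG cH t gfam Pi (bwd c z))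
    (jacobi_response h met ev cG cH t gfam Pi p0).
  by apply: differentiableP; exact: (@ex_diff _ _ _ _ _ _ _ JD).
have near_iso : \forall z \near q,
    bop_iso (jacobi_at h met ev cG cH t gfam Pi (bwd c z)).
  by apply: filterS nearV => z; exact: V_iso.
have PdP := is_diff_pair JdJ (is_diff_bop_inv JdJ near_iso).
move=> D JJ G0 K0 hdot fdot DgJ DfJ.
have DE X : D X = (JJ X, - bop_comp G0 (bop_comp (JJ X) G0)).
  have := congr1 (@^~ X) (@diff_val _ _ _ _ _ _ _ PdP).
  by rewrite /= cq.
split.
- exact: (@ex_diff _ _ _ _ _ _ _ PdP).
- move=> X; split; last first.
    have := congr1 (@^~ X) (@diff_val _ _ _ _ _ _ _ JD).
    by rewrite /= xq yq.
  (* Near [q] the composite is the constant 0, so its chain-rule differential vanishes: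
     [K0 X + J0 (fdot X) = 0]. *)
  have := congr1 (@^~ X) (@diff_val _ _ _ _ _ _ _ (is_diff_near F0 FD)).
  have -> : 'd (F (x q)) (y q) = jacobi_at h met ev cG cH t gfam Pi p0 :> (EH -> EY).
    rewrite -Jq; apply/esym/diff_bopE.
    exact: (@ex_diff _ _ _ _ _ _ _ (is_diff_pair_r (differentiableP dF))).
  rewrite diff_cst /= xq yq => /esym/eqP; rewrite addrC addr_eq0 => /eqP FX.
  have [JG _] := bop_inv_inverse (V_iso _ Vp0).
  by rewrite -[LHS]JG [X in bop_inv _ X]FX linearN.
- exact: DE.
- apply/seteqP; split=> X /=; rewrite DE; first by case.
  move=> ->; congr pair; apply: bopP => v.
  rewrite -[LHS]/(- G0 0) linear0 oppr0; exact: erefl.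
(* Injectivity is transferred on pairs of points through [DE], without passing through the
   kernels. *)
split=> inj X1 X2 X12; apply: inj.
  by rewrite -[LHS]/(D X1) -[RHS]/(D X2) !DE X12.
by have /pair_equal_spec[] : (JJ X1, - bop_comp G0 (bop_comp (JJ X1) G0)) =
    (JJ X2, - bop_comp G0 (bop_comp (JJ X2) G0)) by rewrite -!DE; exact: X12.
Qed.
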